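(* Algorithm 2 (described in the context) is correct: when run on a single-homomorphism system $S$ in standard form, if it stops with failure then $S$ has no unifier modulo one-sided distributivity, and if it exits with success then $S$ is unifiable modulo one-sided distributivity.
   Context: One-sided distributivity: the equational theory over binary $+,\times$ generated by $X \times (Y+Z) = X\times Y + X \times Z$; unification is elementary. Typed setting: types $\tau_1,\tau_2$ with $\times:\tau_1*\tau_2\to\tau_2$, $+:\tau_2*\tau_2\to\tau_2$. A single-homomorphism system in standard form is a finite set of equations with exactly one variable $T$ of type $\tau_1$, each equation of the form $X=^?Y$ ($Y\ne X$), $X =^? Y+Z$ or $X =^? T\times Y$ (written $X=^?h(Y)$), all of $X,Y,Z$ of type $\tau_2$. Data structures. The graph $\mathcal{LD}$: nodes are $\tau_2$-variables; a lateral edge $X \xrightarrow{h^n} Y$ ($n\ge 1$, $n$ stored in binary) represents the equation $X = h^n(Y)$ (initially one edge labeled $h^1$ per equation $X=^?h(Y)$); downward edges $X\to X_1$, $X \to X_2$ for each equation $X=^?X_1+X_2$. Let $\sim_h$ be the equivalence closure of the lateral-edge relation; $\mathcal{LP}$ has the $\sim_h$-classes as vertices and an edge $[X]\to[Y]$ iff some $U\in[X]$ has a downward edge to some $V\in[Y]$. The order $[X]\gtrdot_h[Y]$ holds iff there is such an edge. Inference rules. (0) If $U =^? V$ is present and $U$ occurs elsewhere, replace $U$ by $V$ everywhere else. (i) From $U=^?U_1+U_2$, $U=^?U_3+U_4$ derive $U=^?U_1+U_2$, $U_3=^?U_1$, $U_4=^?U_2$. (ii) From $X\xrightarrow{\eta}Y$,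 $Z\xrightarrow{\pi}Y$ with $|\eta|=|\pi|$ derive $X=^?Z$, $Z\xrightarrow{\pi}Y$. (iii) From $X\xrightarrow{\eta}Y$, $X\xrightarrow{\pi}Z$ with $|\eta|=|\pi|$ derive $X\xrightarrow{\pi}Z$, $Y=^?Z$. (iv) From $X\xrightarrow{h^j}Y$, $X\xrightarrow{h^i}Z$ with $j<i$ derive $Y\xrightarrow{h^{i-j}}Z$, $X\xrightarrow{h^i}Z$. (v) From $X\xrightarrow{h^i}Y$, $Y\xrightarrow{h^j}Z$ derive $X\xrightarrow{h^{i+j}}Z$, $Y\xrightarrow{h^j}Z$. (vi) FAIL if $\mathcal{LP}$ or $\mathcal{LD}$ has a cycle. (vii) From $U\xrightarrow{\eta}W$, $U=^?U_1+U_2$ derive $U\xrightarrow{\eta}W$, $W=^?W_1+W_2$, $U_1\xrightarrow{\eta}W_1$, $U_2\xrightarrow{\eta}W_2$, where $W_1,W_2$ are fresh variables only if $W$ has no downward edges, and otherwise are the existing summands of $W$. (In each rule the premises are replaced by the conclusions.) Algorithm 2. Step 1: build $\mathcal{LD}$ and $\mathcal{LP}$. Step 2: exhaustively apply (0)–(iv). Step 3: if a cycle is found in either graph, stop with failure. Step 4: select a not yet processed class that is maximal for $\gtrdot_h$ among unprocessed classes; in it apply rule (v) exhaustively, starting at the sink of each path and working back to its start node, then apply (vii) if applicable. Step 5: if no rule applies and no cycle exists, exit with success; otherwise return to Step 2. *)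

(* Defs.v *)
From HB Require Import structures.
From mathcomp Require Import all_boot finmap.
From Stdlib Require Import Relations.

Set Implicit Arguments.
Unset Strict Implicit.
Unset Printing Implicit Defensive.

Local Open Scope fset_scope.

(** * Typed terms modulo one-sided distributivity *)

Inductive sort := tau1 | tau2.

(* Elementary unification: the signature contains + and * only, so that the
   terms of sort tau1 are exactly the variables of sort tau1.  Variables of
   each sort are named by natural numbers; [Var tau1 n] and [Var tau2 n] are
   different variables. *)
Inductive term : sort -> Type :=
  | Var (s : sort) (x : nat) : term s
  | Times (t : term tau1) (u : term tau2) : term tau2
  | Plus (u v : term tau2) : term tau2.

Inductive distr_eq : forall s : sort, term s -> term s -> Prop :=
  | distr_ax x y z :
      distr_eq (Times x (Plus y z)) (Plus (Times x y) (Times x z))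
  | distr_refl s (t : term s) : distr_eq t t
  | distr_sym s (t u : term s) : distr_eq t u -> distr_eq u t
  | distr_trans s (t u v : term s) :
      distr_eq t u -> distr_eq u v -> distr_eq t v
  | distr_times x x' y y' :
      distr_eq x x' -> distr_eq y y' -> distr_eq (Times x y) (Times x' y')
  | distr_plus x x' y y' :
      distr_eq x x' -> distr_eq y y' -> distr_eq (Plus x y) (Plus x' y').

Definition substitution := forall s : sort, nat -> term s.

Fixpoint subst (f : substitution) (s : sort) (t : term s) : term s :=
  match t in term s return term s with
  | Var s x => f s x
  | Times t u => Times (subst f t) (subst f u)
  | Plus u v => Plus (subst f u) (subst f v)
  end.

(** * Single-homomorphism systems in standard form *)

Inductive equation :=
  | EqVar (X Y : nat)      (* X =? Y *)
  | EqPlus (X Y Z : nat)   (* X =? Y + Z *)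
  | EqTimes (X T Y : nat). (* X =? T * Y, with T of sort tau1 *)

Definition equation_code (e : equation) :
    (nat * nat) + ((nat * nat * nat) + (nat * nat * nat)) :=
  match e with
  | EqVar X Y => inl (X, Y)
  | EqPlus X Y Z => inr (inl (X, Y, Z))
  | EqTimes X T Y => inr (inr (X, T, Y))
  end.

Definition equation_decode
    (c : (nat * nat) + ((nat * nat * nat) + (nat * nat * nat))) : equation :=
  match c with
  | inl (X, Y) => EqVar X Y
  | inr (inl (X, Y, Z)) => EqPlus X Y Z
  | inr (inr (X, T, Y)) => EqTimes X T Y
  end.

Lemma equation_codeK : cancel equation_code equation_decode.
Proof. by case. Qed.

HB.instance Definition _ := Equality.copy equation (can_type equation_codeK).
HB.instance Definition _ := Choice.copy equation (can_type equation_codeK).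

Definition lhs (e : equation) : term tau2 :=
  match e with
  | EqVar X _ | EqPlus X _ _ | EqTimes X _ _ => Var tau2 X
  end.

Definition rhs (e : equation) : term tau2 :=
  match e with
  | EqVar _ Y => Var tau2 Y
  | EqPlus _ Y Z => Plus (Var tau2 Y) (Var tau2 Z)
  | EqTimes _ T Y => Times (Var tau1 T) (Var tau2 Y)
  end.

Definition single_hom_system (S : {fset equation}) : Prop :=
  (forall X Y, EqVar X Y \in S -> Y <> X) /\
  (exists! T, exists X Y, EqTimes X T Y \in S).

Definition unifier (S : {fset equation}) (f : substitution) : Prop :=
  forall e, e \in S -> distr_eq (subst f (lhs e)) (subst f (rhs e)).

Definition unifiable (S : {fset equation}) : Prop := exists f, unifier S f.

(** * States of the algorithm *)

(* A state is a finite set of items; it carries both the graph LD and the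
   pending equations between variables.  [Sum X X1 X2] stands at once for the
   equation X =? X1 + X2 and for the two downward edges from X. *)
Inductive item :=
  | Eqn (X Y : nat)        (* X =? Y *)
  | Sum (X X1 X2 : nat)    (* X =? X1 + X2 *)
  | Lat (X n Y : nat).     (* lateral edge X --h^n--> Y, i.e. X = h^n(Y) *)

Definition item_code (e : item) :
    (nat * nat) + ((nat * nat * nat) + (nat * nat * nat)) :=
  match e with
  | Eqn X Y => inl (X, Y)
  | Sum X X1 X2 => inr (inl (X, X1, X2))
  | Lat X n Y => inr (inr (X, n, Y))
  end.

Definition item_decode
    (c : (nat * nat) + ((nat * nat * nat) + (nat * nat * nat))) : item :=
  match c with
  | inl (X, Y) => Eqn X Y
  | inr (inl (X, X1, X2)) => Sum X X1 X2
  | inr (inr (X, n, Y)) => Lat X n Y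
  end.

Lemma item_codeK : cancel item_code item_decode.
Proof. by case. Qed.

HB.instance Definition _ := Equality.copy item (can_type item_codeK).
HB.instance Definition _ := Choice.copy item (can_type item_codeK).

Definition state := {fset item}.

(* The variable T is forgotten: h(Y) abbreviates T * Y for the only T. *)
Definition init_item (e : equation) : item :=
  match e with
  | EqVar X Y => Eqn X Y
  | EqPlus X Y Z => Sum X Y Z
  | EqTimes X _ Y => Lat X 1 Y
  end.

Definition init_state (S : {fset equation}) : state :=
  [fset init_item e | e in S].

Definition item_vars (e : item) : seq nat :=
  match e with
  | Eqn X Y => [:: X; Y]
  | Sum X X1 X2 => [:: X; X1; X2]
  | Lat X _ Y => [:: X; Y]
  end.

Definition occurs (s : state) (X : nat) : Prop :=
  exists2 e, e \in s & X \in item_vars e.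

Definition lateral (s : state) (X Y : nat) : Prop := exists n, Lat X n Y \in s.

Definition downward (s : state) (X Y : nat) : Prop :=
  exists Z, Sum X Y Z \in s \/ Sum X Z Y \in s.

Definition sim_h (s : state) : relation nat :=
  clos_refl_sym_trans nat (lateral s).

(* The edge [X] -> [Y] of LP, which is also the order of the classes [X] and
   [Y].  The vertices of LP are handled through representatives: the relation
   below is invariant under sim_h in both arguments. *)
Definition class_gt (s : state) (X Y : nat) : Prop :=
  exists U V, [/\ sim_h s X U, sim_h s Y V & downward s U V].

Definition cyclic (r : relation nat) : Prop := exists X, clos_trans nat r X X.

Definition LD_edge (s : state) (X Y : nat) : Prop :=
  lateral s X Y \/ downward s X Y.

Definition has_cycle (s : state) : Prop :=
  cyclic (class_gt s) \/ cyclic (LD_edge s).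

(** * Inference rules *)

Definition replace (s premises conclusions : state) : state :=
  (s `\` premises) `|` conclusions.

Definition rename (U V X : nat) : nat := if X == U then V else X.

Definition rename_item (U V : nat) (e : item) : item :=
  match e with
  | Eqn X Y => Eqn (rename U V X) (rename U V Y)
  | Sum X X1 X2 => Sum (rename U V X) (rename U V X1) (rename U V X2)
  | Lat X n Y => Lat (rename U V X) n (rename U V Y)
  end.

(* Rule (i) may derive a trivial equation U =? U, to which replacing U by U
   does not apply: hence U <> V. *)
Inductive rule0 (s : state) : state -> Prop :=
  | Rule0 U V :
      Eqn U V \in s -> U <> V -> occurs (s `\ Eqn U V) U ->
      rule0 s (Eqn U V |` [fset rename_item U V e | e in s `\ Eqn U V]).

(* In rules (i)-(iii) the two premises are different elements of the state. *)
Inductive rule1 (s : state) : state -> Prop :=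
  | Rule1 U U1 U2 U3 U4 :
      Sum U U1 U2 \in s -> Sum U U3 U4 \in s -> (U1, U2) <> (U3, U4) ->
      rule1 s (replace s [fset Sum U U1 U2; Sum U U3 U4]
                         [fset Sum U U1 U2; Eqn U3 U1; Eqn U4 U2]).

Inductive rule2 (s : state) : state -> Prop :=
  | Rule2 X Y Z n :
      Lat X n Y \in s -> Lat Z n Y \in s -> X <> Z ->
      rule2 s (replace s [fset Lat X n Y; Lat Z n Y]
                         [fset Eqn X Z; Lat Z n Y]).

Inductive rule3 (s : state) : state -> Prop :=
  | Rule3 X Y Z n :
      Lat X n Y \in s -> Lat X n Z \in s -> Y <> Z ->
      rule3 s (replace s [fset Lat X n Y; Lat X n Z]
                         [fset Lat X n Z; Eqn Y Z]).

Inductive rule4 (s : state) : state -> Prop :=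
  | Rule4 X Y Z i j :
      Lat X j Y \in s -> Lat X i Z \in s -> j < i ->
      rule4 s (replace s [fset Lat X j Y; Lat X i Z]
                         [fset Lat Y (i - j) Z; Lat X i Z]).

(* [rule5 X Z] is rule (v) for a path from X to Z, [rule7 U] is rule (vii) for
   the equation U =? U1 + U2. *)
Inductive rule5 (X Z : nat) (s : state) : state -> Prop :=
  | Rule5 Y i j :
      Lat X i Y \in s -> Lat Y j Z \in s ->
      rule5 X Z s (replace s [fset Lat X i Y; Lat Y j Z]
                             [fset Lat X (i + j) Z; Lat Y j Z]).

Definition rule7_result (s : state) (U n W U1 U2 W1 W2 : nat) : state :=
  replace s [fset Lat U n W; Sum U U1 U2]
            [fset Lat U n W; Sum W W1 W2; Lat U1 n W1; Lat U2 n W2].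

Inductive rule7 (U : nat) (s : state) : state -> Prop :=
  | Rule7_fresh n W U1 U2 W1 W2 :
      Lat U n W \in s -> Sum U U1 U2 \in s ->
      (forall V, ~ downward s W V) ->
      ~ occurs s W1 -> ~ occurs s W2 -> W1 <> W2 ->
      rule7 U s (rule7_result s U n W U1 U2 W1 W2)
  | Rule7_existing n W U1 U2 W1 W2 :
      Lat U n W \in s -> Sum U U1 U2 \in s -> Sum W W1 W2 \in s ->
      rule7 U s (rule7_result s U n W U1 U2 W1 W2).

Definition rules0_4 (s s' : state) : Prop :=
  [\/ rule0 s s', rule1 s s', rule2 s s' | rule3 s s' \/ rule4 s s'].

Definition some_rule_applies (s : state) : Prop :=
  exists s', [\/ rules0_4 s s', (exists X Z, rule5 X Z s s')
              | (exists U, rule7 U s s')].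

(** * The algorithm *)

Definition exhaust (r : relation state) (s s' : state) : Prop :=
  clos_refl_trans state r s s' /\ forall s'', ~ r s' s''.

Definition sink (s : state) (Z : nat) : Prop := forall Y, ~ lateral s Z Y.

(* Shortening only the paths X -> Y -> Z that end in a sink Z amounts to
   working from the sink of a path back to its start node. *)
Definition rule5_in (C : nat -> Prop) (s s' : state) : Prop :=
  exists X Z, [/\ C X, sink s Z & rule5 X Z s s'].

Definition rule7_in (C : nat -> Prop) (s s' : state) : Prop :=
  exists2 U, C U & rule7 U s s'.

(* Processed classes are recorded by marking their members with the predicate
   P; a class having an unmarked member is unprocessed. *)
Definition unprocessed (s : state) (P : nat -> Prop) (X : nat) : Prop :=
  occurs s X /\ exists2 Y, sim_h s X Y & ~ P Y.

Definition selectable (s : state) (P : nat -> Prop) (X : nat) : Prop :=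
  unprocessed s P X /\ forall Y, unprocessed s P Y -> ~ class_gt s Y X.

(* Step 4 does nothing once every class has been processed. *)
Inductive step4 (s : state) (P : nat -> Prop) :
    state -> (nat -> Prop) -> Prop :=
  | Step4_select X s1 s2 :
      selectable s P X ->
      exhaust (rule5_in (sim_h s X)) s s1 ->
      exhaust (rule7_in (sim_h s X)) s1 s2 ->
      step4 s P s2 (fun Y => P Y \/ sim_h s X Y)
  | Step4_none :
      (forall X, ~ unprocessed s P X) -> step4 s P s P.

Inductive outcome := Failure | Success.

(* [run s P o]: some execution starting at Step 2 in the state s, with the
   processed classes marked by P, stops with outcome o. *)
Inductive run (s : state) (P : nat -> Prop) : outcome -> Prop :=
  | Run_failure s1 :
      exhaust rules0_4 s s1 -> has_cycle s1 -> run s P Failure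
  | Run_success s1 s2 P2 :
      exhaust rules0_4 s s1 -> ~ has_cycle s1 -> step4 s1 P s2 P2 ->
      ~ some_rule_applies s2 -> ~ has_cycle s2 -> run s P Success
  | Run_loop s1 s2 P2 o :
      exhaust rules0_4 s s1 -> ~ has_cycle s1 -> step4 s1 P s2 P2 ->
      some_rule_applies s2 \/ has_cycle s2 -> run s2 P2 o -> run s P o.

Definition algorithm2 (S : {fset equation}) (o : outcome) : Prop :=
  run (init_state S) (fun _ => False) o.

(* Main.v *)
Require Import Defs.
From mathcomp Require Import all_boot finmap.
From Stdlib Require Import Relations.

(** Oriented as a rewrite rule, one-sided distributivity pushes products inside
    sums, and a term of sort [tau2] normalizes to a binary tree whose leaves are
    variables preceded by a word of [tau1]-variables.  On such trees [+] is a
    free pairing and [h] adds a letter in front of the word at every leaf: [h] is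
    injective and [h^n(w)] is a sum only when [w] is one.  Hence every inference
    rule preserves solvability in both directions.  A solution excludes cycles
    of [LP], since [h] preserves the depth that [+] increases, and cycles of
    [LD], since both operations increase the total length of the leaves.
    Conversely, in an acyclic state to which no rule applies every variable has
    at most one defining item, so the solution is obtained by unfolding. *)

Set Implicit Arguments.
Unset Strict Implicit.
Unset Printing Implicit Defensive.

Local Open Scope fset_scope.

(** * Normal forms *)

Inductive tree := Leaf (w : seq nat) (x : nat) | Node (a b : tree).

Fixpoint act (t : nat) (a : tree) : tree :=
  match a with
  | Leaf w x => Leaf (t :: w) x
  | Node a b => Node (act t a) (act t b)
  end.

(** Terms of sort [tau1] are variables, so their names already serve as normal forms. *)
Definition value (s : Defs.sort) : Type :=
  match s with tau1 => nat | tau2 => tree end.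

Fixpoint nf (s : Defs.sort) (t : term s) : value s :=
  match t in term s return value s with
  | Var s x => match s return value s with tau1 => x | tau2 => Leaf [::] x end
  | Times t u => act (nf t) (nf u)
  | Plus u v => Node (nf u) (nf v)
  end.

Fixpoint tree_term (a : tree) : term tau2 :=
  match a with
  | Leaf w x => foldr (fun t u => Times (Var tau1 t) u) (Var tau2 x) w
  | Node a b => Plus (tree_term a) (tree_term b)
  end.

Definition reify (s : Defs.sort) : value s -> term s :=
  match s return value s -> term s with
  | tau1 => Var tau1
  | tau2 => tree_term
  end.

(** The axiom holds by computation, since [act] distributes over [Node]; only transitivity and the
    two congruences need the induction hypotheses explicitly. *)
Lemma nf_distr_eq s (t u : term s) : distr_eq t u -> nf t = nf u.
Proof.
by elim=> //= [s' t' u' v' _ -> _ ->|x x' y y' _ -> _ ->|x x' y y' _ -> _ ->].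
Qed.

Lemma tree_term_act t a :
  distr_eq (Times (Var tau1 t) (tree_term a)) (tree_term (act t a)).
Proof.
elim: a => [w x|a IHa b IHb] /=; first exact: distr_refl.
apply: distr_trans (distr_plus IHa IHb); exact: distr_ax.
Qed.

Lemma reify_nf s (t : term s) : distr_eq t (reify (nf t)).
Proof.
elim: t => [[] x|t IHt u IHu|u IHu v IHv] /=.
- exact: distr_refl.
- exact: distr_refl.
- apply: distr_trans (tree_term_act _ _); exact: distr_times.
- exact: distr_plus.
Qed.

Lemma distr_eq_nf s (t u : term s) : nf t = nf u -> distr_eq t u.
Proof.
move=> tu; apply: distr_trans (reify_nf t) _; rewrite tu.
exact/distr_sym/reify_nf.
Qed.

Lemma nf_tree_term a : nf (tree_term a) = a.
Proof.
elim: a => [w x|a IHa b IHb] /=; last by rewrite IHa IHb.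
by elim: w => //= t w ->.
Qed.

Lemma act_inj t : injective (act t).
Proof.
elim=> [w x|a IHa b IHb] [w' x'|a' b'] //=; first by case=> -> ->.
by case=> /IHa -> /IHb ->.
Qed.

Lemma iter_act_inj n t : injective (iter n (act t)).
Proof. by elim: n => // n IHn a b /= /act_inj /IHn. Qed.

Lemma iter_act_Node n t a b :
  iter n (act t) (Node a b) = Node (iter n (act t) a) (iter n (act t) b).
Proof. by elim: n => //= n ->. Qed.

(** Applying [act] to a leaf gives a leaf, so a node can only come from a node. This supplies the
    values of the fresh summands in rule (vii). *)
Lemma iter_act_NodeI n t a u v :
  iter n (act t) a = Node u v ->
  exists b c, [/\ a = Node b c, u = iter n (act t) b & v = iter n (act t) c].
Proof.
case: a => [w x|b c]; last by rewrite iter_act_Node => -[<- <-]; exists b, c.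
suff [w' ->] : exists w', iter n (act t) (Leaf w x) = Leaf w' x by [].
by elim: n => [|n [w' /= ->]]; [exists w|exists (t :: w')].
Qed.

(** * Two measures on trees: depth for [LP], weight for [LD] *)

Fixpoint depth (a : tree) : nat :=
  if a is Node a b then (maxn (depth a) (depth b)).+1 else 0.

(** The successor counts the variable of the leaf, so that no tree weighs 0 and a sum outweighs each
    summand. *)
Fixpoint weight (a : tree) : nat :=
  match a with
  | Leaf w _ => (size w).+1
  | Node a b => weight a + weight b
  end.

Lemma depth_iter_act n t a : depth (iter n (act t) a) = depth a.
Proof.
elim: n => //= n <-; move: (iter n _ a).
by elim=> //= b -> c ->.
Qed.

Lemma weight_gt0 a : 0 < weight a.
Proof. by elim: a => //= a a_gt0 b _; rewrite addn_gt0 a_gt0. Qed.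

Lemma weight_iter_act n t a : weight a + n <= weight (iter n (act t) a).
Proof.
have weight_act b : weight b < weight (act t b).
  elim: b => //= b IHb c IHc; rewrite -addSn; exact: leq_add IHb (ltnW IHc).
elim: n => [|n IHn] /=; first by rewrite addn0.
by rewrite addnS; apply: leq_ltn_trans (weight_act _).
Qed.

(** * Solvability of states *)

(** The letter [t] is the value of the unique [tau1]-variable; it is fixed while the assignment [g]
    may change from state to state. *)
Definition holds (t : nat) (g : nat -> tree) (e : item) : Prop :=
  match e with
  | Eqn X Y => g X = g Y
  | Sum X X1 X2 => g X = Node (g X1) (g X2)
  | Lat X n Y => g X = iter n (act t) (g Y)
  end.

Definition sat (t : nat) (g : nat -> tree) (s : state) : Prop :=
  forall e, e \in s -> holds t g e.

Definition solvable (t : nat) (s : state) : Prop := exists g, sat t g s.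

Lemma sat_replace t g (s p c : state) :
  sat t g s -> sat t g c -> sat t g (replace s p c).
Proof. by move=> gs gc e /fsetUP[/fsetDP[/gs]|/gc]. Qed.

(** Items outside [p] survive the replacement, so only the premises have to be recovered from the
    conclusions. *)
Lemma sat_unreplace t g (s p c : state) :
  (sat t g c -> sat t g p) -> sat t g (replace s p c) -> sat t g s.
Proof.
move=> gcp gr; have gp : sat t g p by apply: gcp => e ec; apply/gr/fsetUP; right.
move=> e es; case: (boolP (e \in p)) => [/gp //|ep].
by apply/gr/fsetUP; left; apply/fsetDP.
Qed.

Lemma sat_fset1 t g e : sat t g [fset e] <-> holds t g e.
Proof. by split=> [|ge _ /fset1P -> //]; apply; apply: fset11. Qed.

Lemma sat_fsetU t g (a b : state) :
  sat t g (a `|` b) <-> sat t g a /\ sat t g b.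
Proof.
split=> [gab|[ga gb] e /fsetUP[/ga|/gb] //].
by split=> e e_in; apply/gab/fsetUP; [left|right].
Qed.

Lemma holds_rename t g U V e :
  g U = g V -> holds t g (rename_item U V e) <-> holds t g e.
Proof.
move=> gUV; have gE X : g (rename U V X) = g X.
  by rewrite /rename; case: eqP => // ->.
by case: e => * /=; rewrite !gE.
Qed.

Lemma eq_holds t g g' e :
  {in item_vars e, g =1 g'} -> holds t g e -> holds t g' e.
Proof.
by case: e => [X Y|X Y Z|X n Y] /= gg'; rewrite !gg' ?inE ?eqxx ?orbT.
Qed.

(** The strategy is forgotten: solvability is compared rule by rule, whatever the order of
    application. *)
Inductive step (s : state) : state -> Prop :=
  | Step04 s' : rules0_4 s s' -> step s s'
  | Step5 X Z s' : rule5 X Z s s' -> step s s'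
  | Step7 U s' : rule7 U s s' -> step s s'.

(** The assignment is kept, except in rule (vii) with fresh variables, where it is changed at these.
    Rule (i) uses injectivity of [Node], rules (iii) and (iv) that of [act]. *)
Lemma step_sound t s s' : step s s' -> solvable t s -> solvable t s'.
Proof.
case=> {s'} [s' []|X Z _ [Y i j] Xi Yj|U _ [n W U1 U2 W1 W2|n W U1 U2 W1 W2]].
- case=> U V UV _ _ [g gs]; exists g => e /fset1UP[-> |]; first exact: gs UV.
  by case/imfsetP=> e' /fsetD1P[_ /gs ge' ->]; apply/holds_rename; first apply: (gs _ UV).
- case=> U U1 U2 U3 U4 U12 U34 _ [g gs]; exists g; apply: sat_replace => //.
  move: (gs _ U12) (gs _ U34) => /= g12 g34.
  move: (g12); rewrite g34 => -[g31 g42].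
  by rewrite !sat_fsetU !sat_fset1.
- case=> X Y Z n Xn Zn _ [g gs]; exists g; apply: sat_replace => //.
  move: (gs _ Xn) (gs _ Zn) => /= gX gZ.
  by rewrite sat_fsetU !sat_fset1 /= gX gZ.
- case.
  + case=> X Y Z n Xn Xn' _ [g gs]; exists g; apply: sat_replace => //.
    move: (gs _ Xn) (gs _ Xn') => /= gY gZ.
    rewrite sat_fsetU !sat_fset1 /=; split=> //.
    by apply: (@iter_act_inj n t); rewrite -gY.
  + case=> X Y Z i j Xj Xi ji [g gs]; exists g; apply: sat_replace => //.
    move: (gs _ Xj) (gs _ Xi) => /= gY gZ.
    rewrite sat_fsetU !sat_fset1 /=; split=> //.
    by apply: (@iter_act_inj j t); rewrite -iterD subnKC ?(ltnW ji) // -gY.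
- move=> [g gs]; exists g; apply: sat_replace => //.
  move: (gs _ Xi) (gs _ Yj) => /= gX gY.
  by rewrite sat_fsetU !sat_fset1 /= iterD -gY.
- move=> UW U12 _ W1s W2s W12 [g gs].
  move: (gs _ UW) (gs _ U12) => /= gU gU12.
  have [w1 [w2 [gW gU1 gU2]]] := iter_act_NodeI (esym (etrans (esym gU12) gU)).
  (* The fresh summands receive the two halves of [g W]; freshness makes [g'] agree with [g] on
     every variable of [s]. *)
  pose g' X := if X == W1 then w1 else if X == W2 then w2 else g X.
  have g'E X : occurs s X -> g X = g' X.
    by move=> sX; rewrite /g'; case: eqP sX => [-> /W1s//|_];
       case: eqP => [-> /W2s|].
  have g's : sat t g' s.
    by move=> e es; apply: eq_holds (gs e es) => X Xe; apply: g'E; exists e.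
  have g'W : g' W = Node w1 w2.
    by rewrite -g'E ?gW //; exists (Lat U n W); rewrite // !inE eqxx orbT.
  have g'U1 : g' U1 = iter n (act t) w1.
    by rewrite -g'E //; exists (Sum U U1 U2); rewrite // !inE eqxx orbT.
  have g'U2 : g' U2 = iter n (act t) w2.
    by rewrite -g'E //; exists (Sum U U1 U2); rewrite // !inE eqxx !orbT.
  have g'W1 : g' W1 = w1 by rewrite /g' eqxx.
  have g'W2 : g' W2 = w2.
    by rewrite /g' eqxx; case: eqP => // W21; case: W12.
  exists g'; apply: sat_replace => //; rewrite !sat_fsetU !sat_fset1 /=.
  by rewrite g'W1 g'W2; do !split=> //; exact: (g's _ UW).
- move=> UW U12 W12 [g gs]; exists g; apply: sat_replace => //.
  move: (gs _ UW) (gs _ U12) (gs _ W12) => /= gU gU12 gW.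
  move: (gU12); rewrite gU gW iter_act_Node => -[g1 g2].
  by rewrite !sat_fsetU !sat_fset1 /= gU gW -g1 -g2.
Qed.

(** In every rule the conclusions imply the premises under the same assignment; for (vii), because
    [h^n] distributes over the sum. *)
Lemma step_complete t s s' : step s s' -> solvable t s' -> solvable t s.
Proof.
have rule7_sat g U n W U1 U2 W1 W2 :
    sat t g (rule7_result s U n W U1 U2 W1 W2) -> sat t g s.
  apply: sat_unreplace; rewrite !sat_fsetU !sat_fset1 /=.
  by case=> -[[gU gW] g1] g2; rewrite gU gW iter_act_Node g1 g2.
case=> {s'} [s' []|X Z _ [Y i j] _ _|U _ [n W U1 U2 W1 W2|n W U1 U2 W1 W2]].
- case=> U V UV _ _ [g gs]; exists g => e es.
  have gUV : g U = g V by apply: (gs (Eqn U V)); apply: fset1U1.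
  case: (eqVneq e (Eqn U V)) => [-> //|eUV].
  rewrite -(holds_rename _ _ gUV); apply/gs/fset1UP; right.
  by apply: in_imfset; apply/fsetD1P.
- case=> U U1 U2 U3 U4 _ _ _ [g gs]; exists g; apply: sat_unreplace gs.
  by rewrite !sat_fsetU !sat_fset1 /= => -[[-> ->] ->].
- case=> X Y Z n _ _ _ [g gs]; exists g; apply: sat_unreplace gs.
  by rewrite !sat_fsetU !sat_fset1 /= => -[-> ->].
- case.
  + case=> X Y Z n _ _ _ [g gs]; exists g; apply: sat_unreplace gs.
    by rewrite !sat_fsetU !sat_fset1 /= => -[-> ->].
  + case=> X Y Z i j _ _ ji [g gs]; exists g; apply: sat_unreplace gs.
    rewrite !sat_fsetU !sat_fset1 /= => -[-> ->].
    by rewrite -iterD subnKC ?(ltnW ji).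
- move=> [g gs]; exists g; apply: sat_unreplace gs.
  by rewrite !sat_fsetU !sat_fset1 /= => -[-> ->]; rewrite iterD.
- by move=> _ _ _ _ _ _ [g /rule7_sat]; exists g.
- by move=> _ _ _ [g /rule7_sat]; exists g.
Qed.

(** An edge labeled [h^0] could form a loop in a solvable state; positive labels make the weight
    drop strictly along lateral edges. *)
Definition positive (s : state) : Prop :=
  forall X n Y, Lat X n Y \in s -> 0 < n.

Lemma step_positive s s' : step s s' -> positive s -> positive s'.
Proof.
have replace_pos (p c : state) :
    positive s -> positive c -> positive (replace s p c).
  by move=> sp cp X n Y /fsetUP[/fsetDP[/sp]|/cp].
have rule7_pos U n W U1 U2 W1 W2 :
    Lat U n W \in s -> positive s ->
    positive (rule7_result s U n W U1 U2 W1 W2).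
  move=> UW sp; apply: replace_pos => // X m Y; rewrite !inE.
  by case/orP=> [/orP[/orP[|]|]|] /eqP // [_ -> _]; exact: sp UW.
case=> {s'} [s' []|X Z _ [Y i j] Xi Yj|U _ [n W U1 U2 W1 W2|n W U1 U2 W1 W2]].
- case=> U V UV _ _ sp X n Y /fset1UP[//|/imfsetP[[] //= X' m Y']].
  by case/fsetD1P=> _ /sp m_gt0 [_ -> _].
- case=> U U1 U2 U3 U4 _ _ _ sp; apply: replace_pos => // X n Y.
  by rewrite !inE => /orP[/orP[]|] /eqP.
- case=> X Y Z n _ Zn _ sp; apply: replace_pos => // A m B.
  by rewrite !inE => /orP[] /eqP // [_ -> _]; exact: sp Zn.
- case.
  + case=> X Y Z n _ Zn _ sp; apply: replace_pos => // A m B.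
    by rewrite !inE => /orP[] /eqP // [_ -> _]; exact: sp Zn.
  + case=> X Y Z i j _ Xi ji sp; apply: replace_pos => // A m B.
    rewrite !inE => /orP[] /eqP[_ -> _]; last exact: sp Xi.
    by rewrite subn_gt0.
- move=> sp; apply: replace_pos => // A m B.
  rewrite !inE => /orP[] /eqP[_ -> _]; last exact: sp Yj.
  by rewrite addn_gt0 (sp _ _ _ Xi).
- by move=> UW _ _ _ _ _; apply: rule7_pos.
- by move=> UW _ _; apply: rule7_pos.
Qed.

(** * Failure *)

Lemma acyclic_measure (r : relation nat) (m : nat -> nat) :
  (forall X Y, r X Y -> m Y < m X) -> ~ cyclic r.
Proof.
move=> rm [X rXX]; suff r_lt A B : clos_trans _ r A B -> m B < m A.
  by have := r_lt _ _ rXX; rewrite ltnn.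
elim=> {A B} [A B /rm //|A B C _ BA _ CB]; exact: ltn_trans CB BA.
Qed.

Lemma solvable_acyclic t s : positive s -> solvable t s -> ~ has_cycle s.
Proof.
move=> sp [g gs]; have downE X Y : downward s X Y ->
    exists Z, g X = Node (g Y) (g Z) \/ g X = Node (g Z) (g Y).
  by case=> Z [] /gs gX; exists Z; [left|right].
case.
- apply: (@acyclic_measure _ (depth \o g)) => X Y [U [V [XU YV UV]]] /=.
  (* Depth is constant on classes, hence a measure on the vertices of [LP]. *)
  have sim A B : sim_h s A B -> depth (g A) = depth (g B).
    elim=> {A B} [A B [n /gs /= ->]|//|A B _ ->|A B C _ -> _ ->] //.
    exact: depth_iter_act.
  rewrite (sim _ _ XU) (sim _ _ YV).
  by have [Z [->|->]] := downE _ _ UV; rewrite ltnS ?leq_maxl ?leq_maxr.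
- apply: (@acyclic_measure _ (weight \o g)) => X Y [[n XY]|/downE[Z gX]] /=.
    rewrite (gs _ XY) /=; apply: leq_trans (weight_iter_act _ _ _).
    by rewrite -[X in X < _]addn0 ltn_add2l (sp _ _ _ XY).
  case: gX => -> /=; rewrite -[X in X < _]addn0 ?(addnC (weight (g Z)));
    by rewrite ltn_add2l weight_gt0.
Qed.

(** * Success *)

Lemma occurs_flatten (s : state) X :
  occurs s X <-> X \in flatten [seq item_vars e | e <- s].
Proof.
split=> [[e es Xe]|/flatten_mapP[e es Xe]]; last by exists e.
by apply/flatten_mapP; exists e.
Qed.

Lemma fresh_variable (s : state) : exists N, forall X, N <= X -> ~ occurs s X.
Proof.
(* A sum of naturals bounds each of its terms. *)
exists (sumn (flatten [seq item_vars e | e <- s])).+1 => X ltX /occurs_flatten.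
elim: (flatten _) ltX => //= Y v IHv ltX /predU1P[XY|].
  by move: ltX; rewrite XY ltnNge leq_addr.
by apply: IHv; apply: leq_ltn_trans ltX; apply: leq_addl.
Qed.

(** * Defining items and their uniqueness in irreducible states *)

Definition defines (X : nat) (e : item) : bool :=
  match e with
  | Eqn _ _ => false
  | Sum Y _ _ => Y == X
  | Lat Y _ _ => Y == X
  end.

Lemma defines_item_vars X e : defines X e -> X \in item_vars e.
Proof. by case: e => //= [Y Y1 Y2|Y n Z] /eqP ->; apply: mem_head. Qed.

Definition definition (s : state) (X : nat) : option item :=
  ohead [seq e <- s | defines X e].

Lemma definition_mem s X e :
  definition s X = Some e -> e \in s /\ defines X e.
Proof.
rewrite /definition; case def_e: [seq _ <- _ | _] => [//|a v] [<-].
have : a \in [seq e <- s | defines X e] by rewrite def_e mem_head.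
by rewrite mem_filter => /andP[].
Qed.

(** Otherwise rule (vii) applies: with the existing summands if [Y] has some, and else with the
    fresh variables [N] and [N.+1]. *)
Lemma irreducible_no_Sum s X n Y X1 X2 :
  (forall s', ~ step s s') -> Lat X n Y \in s -> Sum X X1 X2 \notin s.
Proof.
move=> irr XY; apply/negP => X12.
case: (boolP (has (fun e => if e is Sum Z _ _ then Z == Y else false) s)).
  case/hasP=> -[//|Z Y1 Y2|//] Y12 /eqP ZY; rewrite ZY in Y12.
  exact: irr (Step7 (Rule7_existing XY X12 Y12)).
move=> /hasPn noY; have [N Nfresh] := fresh_variable s.
have N1fresh := Nfresh _ (leqnSn N).
apply: irr (Step7 (Rule7_fresh XY X12 _ (Nfresh _ (leqnn N)) N1fresh _)).
  by move=> V [Z []] /noY; rewrite eqxx.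
by move=> /eqP; rewrite ltn_eqF.
Qed.

(** Two distinct sums at [X] trigger rule (i), two distinct lateral edges rule (iii) or (iv)
    according to their labels, and a mixed pair rule (vii). *)
Lemma definition_unique s X e e' :
  (forall s', ~ step s s') -> e \in s -> e' \in s ->
  defines X e -> defines X e' -> e = e'.
Proof.
move=> irr.
case: e => // [X' U1 U2|X' n Y] es; case: e' => // [X'' U3 U4|X'' m Z] e's;
  move=> /= /eqP XE /eqP XE'; move: es e's; rewrite {}XE {}XE' => es e's.
- case: (eqVneq (U1, U2) (U3, U4)) => [[-> ->] //|/eqP ne].
  by case: (irr _ (Step04 (Or42 _ _ _ (Rule1 es e's ne)))).
- by case/negP: (@irreducible_no_Sum _ _ _ _ U1 U2 irr e's).
- by case/negP: (@irreducible_no_Sum _ _ _ _ U3 U4 irr es).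
- case: (ltngtP n m) => [nm|mn|nm].
  + by case: (irr _ (Step04 (Or44 _ _ _ (or_intror (Rule4 es e's nm))))).
  + by case: (irr _ (Step04 (Or44 _ _ _ (or_intror (Rule4 e's es mn))))).
  + rewrite nm in es *; case: (eqVneq Y Z) => [-> //|/eqP ne].
    by case: (irr _ (Step04 (Or44 _ _ _ (or_introl (Rule3 es e's ne))))).
Qed.

Lemma definition_Some s e X :
  (forall s', ~ step s s') -> e \in s -> defines X e ->
  definition s X = Some e.
Proof.
move=> irr es Xe; case def: (definition s X) => [e'|].
  have [e's Xe'] := definition_mem def.
  by rewrite (definition_unique irr es e's Xe Xe').
have : e \in [seq e <- s | defines X e] by rewrite mem_filter Xe.
by move: def; rewrite /definition; case: [seq _ <- _ | _].
Qed.

(** Here [n] is fuel. The value [Leaf [::] X] is intended for variables without a defining item, and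
    is only a default when the fuel runs out. *)
Fixpoint unfold_def (t : nat) (s : state) (n X : nat) : tree :=
  if n is n'.+1 then
    match definition s X with
    | Some (Sum _ X1 X2) =>
        Node (unfold_def t s n' X1) (unfold_def t s n' X2)
    | Some (Lat _ k Y) => iter k (act t) (unfold_def t s n' Y)
    | _ => Leaf [::] X
    end
  else Leaf [::] X.

(* [p] is the set of variables visited on the way to [X]; being acyclic, the
   descent visits at most as many variables as occur in [s]. *)
Lemma unfold_def_stable t s n (p : seq nat) X :
  ~ cyclic (LD_edge s) -> uniq p -> {in p, forall Y, occurs s Y} ->
  {in p, forall Y, clos_trans _ (LD_edge s) Y X} ->
  size (flatten [seq item_vars e | e <- s]) <= n + size p ->
  unfold_def t s n X = unfold_def t s n.+1 X.
Proof.
move=> acyc; elim: n p X => [|n IHn] p X p_uniq p_occ pX le_np.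
  rewrite /=; case def: (definition s X) => [e|//].
  have [es Xe] := definition_mem def.
  have sX : occurs s X by exists e; last exact: defines_item_vars.
  have Xp : X \notin p by apply/negP => /pX XX; apply: acyc; exists X.
  (* Pigeonhole: without fuel, [p] is already as long as the list of all occurrences, which leaves
     no room for the new variable [X]. *)
  have : size (X :: p) <= size (flatten [seq item_vars e | e <- s]).
    apply: uniq_leq_size => [|Y /predU1P Y_in]; first by rewrite /= Xp.
    by apply/occurs_flatten; case: Y_in => [->|/p_occ].
  by rewrite leqNgt ltnS le_np.
have child Y : occurs s X -> LD_edge s X Y ->
    unfold_def t s n Y = unfold_def t s n.+1 Y.
  move=> sX XY; apply: (IHn (X :: p)).
  - by rewrite /= p_uniq andbT; apply/negP => /pX XX; apply: acyc; exists X.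
  - by move=> Z /predU1P[->|/p_occ].
  - move=> Z /predU1P[->|/pX ZX]; first exact: t_step.
    by apply: t_trans ZX _; apply: t_step.
  - by rewrite /= addnS -addSn.
rewrite /= -/(unfold_def t s n.+1).
case def: (definition s X) => [e|//]; have [es Xe] := definition_mem def.
have sX : occurs s X by exists e; last exact: defines_item_vars.
case: e es Xe {def} => // [X' X1 X2|X' k Y] es /= /eqP XE; rewrite XE in es.
- by congr Node; apply: child => //; right; [exists X2; left|exists X1; right].
- by congr iter; apply: child => //; left; exists k.
Qed.

(** Any other occurrence of [U] would enable rule (0). *)
Lemma irreducible_Eqn s U V e :
  (forall s', ~ step s s') -> Eqn U V \in s -> U <> V -> e \in s ->
  U \in item_vars e -> e = Eqn U V.
Proof.
move=> irr UVs UV es Ue; apply/eqP/negPn/negP => ne.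
apply: irr (Step04 (Or41 _ _ _ (Rule0 UVs UV _))).
by exists e => //; apply/fsetD1P.
Qed.

Lemma irreducible_solvable t s :
  (forall s', ~ step s s') -> ~ has_cycle s -> solvable t s.
Proof.
move=> irr acyc; pose n := size (flatten [seq item_vars e | e <- s]).
pose g1 := unfold_def t s n.
(* The extra unit of fuel exposes one unfolding, so that [g1] satisfies the defining items. *)
have g1E X : g1 X = unfold_def t s n.+1 X.
  apply: (@unfold_def_stable t s n [::]) => //; last by rewrite addn0.
  by move=> cyc; apply: acyc; right.
pose solves X e := if e is Eqn U V then (U == X) && (U != V) else false.
(* The left side of a nontrivial equation occurs nowhere else, so it can be given the value of its
   right side without disturbing other items. *)
pose g X :=
  if ohead [seq e <- s | solves X e] is Some (Eqn _ V) then g1 V else g1 X.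
have gE X : (forall V, Eqn X V \in s -> X = V) -> g X = g1 X.
  move=> X_free; rewrite /g; case def: [seq _ <- _ | _] => [//|a v].
  have : a \in [seq e <- s | solves X e] by rewrite def mem_head.
  rewrite mem_filter; case: a {def} => // U V /= /andP[/andP[/eqP -> XV]].
  by move=> /X_free XV'; rewrite XV' eqxx in XV.
have gE' e X : e \in s -> (forall U V, e <> Eqn U V) -> X \in item_vars e ->
    g X = g1 X.
  move=> es e_def Xe; apply: gE => V XVs; apply/eqP/negPn/negP => /eqP XV.
  exact: e_def (irreducible_Eqn irr XVs XV es Xe).
exists g => -[X Y|X X1 X2|X k Y] es /=.
- case: (eqVneq X Y) => [-> //|/eqP XY].
  (* [Y] is not itself redirected: as the left side of a nontrivial equation it could not occur in
     [Eqn X Y]. *)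
  rewrite [RHS]gE => [|V YVs].
    rewrite /g; case def: [seq _ <- _ | _] => [|a v].
      have : Eqn X Y \in [seq e <- s | solves X e].
        by rewrite mem_filter /= eqxx es andbT; apply/eqP.
      by rewrite def.
    have : a \in [seq e <- s | solves X e] by rewrite def mem_head.
    rewrite mem_filter; case: a {def} => // U V /= /andP[/andP[/eqP -> _]] XVs.
    by case: (irreducible_Eqn irr es XY XVs (mem_head _ _)) => ->.
  apply/eqP/negPn/negP => /eqP YV.
  by case: (irreducible_Eqn irr YVs YV es (mem_last X [:: Y])) => /XY.
- rewrite !(gE' _ _ es) ?inE ?eqxx ?orbT // g1E /=.
  by rewrite (definition_Some irr es) /=.
- rewrite !(gE' _ _ es) ?inE ?eqxx ?orbT // g1E /=.
  by rewrite (definition_Some irr es) /=.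
Qed.

(** * Runs *)

Lemma exhaust_steps (r : relation state) s s' :
  (forall a b, r a b -> step a b) -> exhaust r s s' ->
  clos_refl_trans _ step s s'.
Proof.
move=> r_step [rs _]; elim: rs => [a b /r_step|a|a b c _ ab _ bc].
- exact: rt_step.
- exact: rt_refl.
- exact: rt_trans ab bc.
Qed.

Lemma step4_steps s P s' P' :
  step4 s P s' P' -> clos_refl_trans _ step s s'.
Proof.
case=> [X s1 s2 _ ex5 ex7|_]; last exact: rt_refl.
apply: (rt_trans _ _ _ s1).
  by apply: exhaust_steps ex5 => a b [A [Z [_ _ /Step5]]].
by apply: exhaust_steps ex7 => a b [A _ /Step7].
Qed.

Lemma run_failure_steps s P :
  run s P Failure -> exists2 s', clos_refl_trans _ step s s' & has_cycle s'.
Proof.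
move def_o: Failure => o srun; elim: srun def_o => // {s P o}.
  by move=> s P s1 ex cyc _; exists s1 => //; apply: exhaust_steps ex => a b /Step04.
move=> s P s1 s2 P2 o ex _ st _ _ IH /IH[s' ss' cyc]; exists s' => //.
apply: rt_trans ss'; apply: rt_trans (step4_steps st).
by apply: exhaust_steps ex => a b /Step04.
Qed.

Lemma run_success_steps s P :
  run s P Success -> exists s', [/\ clos_refl_trans _ step s s',
    forall s'', ~ step s' s'' & ~ has_cycle s'].
Proof.
move def_o: Success => o srun; elim: srun def_o => // {s P o}.
  move=> s P s1 s2 P2 ex _ st irr acyc _; exists s2; split=> //.
    apply: rt_trans (step4_steps st).
    by apply: exhaust_steps ex => a b /Step04.
  move=> s3 st3; apply: irr; exists s3.
  case: st3 => [s' r04|X Z s' r5|U s' r7]; first exact: Or31.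
    by apply: Or32; exists X, Z.
  by apply: Or33; exists U.
move=> s P s1 s2 P2 o ex _ st _ _ IH /IH[s' [ss' irr acyc]]; exists s'.
split=> //; apply: rt_trans ss'; apply: rt_trans (step4_steps st).
by apply: exhaust_steps ex => a b /Step04.
Qed.

Lemma steps_positive s s' :
  clos_refl_trans _ step s s' -> positive s -> positive s'.
Proof. by elim=> [a b /step_positive|//|a b c _ ab _ bc /ab /bc]. Qed.

Lemma steps_solvable t s s' :
  clos_refl_trans _ step s s' -> solvable t s <-> solvable t s'.
Proof.
elim=> [a b ab|//|a b c _ -> _ ->//].
by split; [apply: step_sound ab|apply: step_complete ab].
Qed.

(** * The initial state, and its solutions against unifiers *)

Lemma init_positive S : positive (init_state S).
Proof. by move=> X n Y /imfsetP[[] //= A T B _ [_ -> _]]. Qed.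

(** A unifier may send [T] to another [tau1]-variable, so the letter is read off from [f]. *)
Lemma unifier_solvable S T f :
  (forall X T' Y, EqTimes X T' Y \in S -> T' = T) ->
  unifier S f -> solvable (nf (f tau1 T)) (init_state S).
Proof.
move=> T_uniq fS; exists (fun X => nf (f tau2 X)) => _ /imfsetP[e /= eS ->].
have := nf_distr_eq (fS e eS).
by case: e eS => //= X T' Y /T_uniq ->.
Qed.

(** With the letter chosen as [T], the unifier can fix all [tau1]-variables and read the solution
    back as terms. *)
Lemma solvable_unifiable S T :
  (forall X T' Y, EqTimes X T' Y \in S -> T' = T) ->
  solvable T (init_state S) -> unifiable S.
Proof.
move=> T_uniq [g gS].
exists (fun s => match s with tau1 => Var tau1 | tau2 => tree_term \o g end).
move=> e eS; apply: distr_eq_nf.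
have /gS : init_item e \in init_state S by apply: in_imfset.
by case: e eS => [X Y|X Y Z|X T' Y /T_uniq ->] //=; rewrite !nf_tree_term.
Qed.

Theorem theorem5p8 (S : {fset equation}) (hS : single_hom_system S) :
  (algorithm2 S Failure -> ~ unifiable S) /\
  (algorithm2 S Success -> unifiable S).
Proof.
case: hS => _ [T [_ T_min]].
have T_uniq X T' Y : EqTimes X T' Y \in S -> T' = T.
  by move=> eS; apply/esym/T_min; exists X, Y.
split.
- case/run_failure_steps=> s steps cyc [f /(unifier_solvable T_uniq) solv].
  (* A unifier would make the failing state solvable, which its cycle forbids. *)
  apply: solvable_acyclic (steps_positive steps (@init_positive S)) _ cyc.
  exact: (steps_solvable _ steps).1 solv.
- case/run_success_steps=> s [steps irr acyc].
  apply: (solvable_unifiable T_uniq); apply/(steps_solvable _ steps).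
  exact: irreducible_solvable.
Qed.
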